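(* Suppose $B_1 = -\frac{1}{2}$ and let $n$ and $p$ be integers such that $n \geq 1$, $p \geq 0$. Then $$\begin{aligned} S_p(n) &= n, \quad \text{if } p = 0, \\ &= \begin{cases} \displaystyle \frac{1}{p+1} \sum_{k=0}^{\frac{p}{2}} \binom{p+1}{2k+1} (n+1)^{2k+1} B_{p-2k} - \frac{(n+1)^p}{2}, & \text{if } p \text{ is even}, \\[2ex] \displaystyle \frac{1}{p+1} \sum_{k=1}^{\frac{p+1}{2}} \binom{p+1}{2k} (n+1)^{2k} B_{p-2k+1} - \frac{(n+1)^p}{2}, & \text{if } p \text{ is odd} \end{cases} \\ &= \frac{1}{p+1} \sum_{k=0}^{p} \binom{p+1}{k} n^{p-k+1} B_k + n^p = \frac{1}{p+1} \sum_{k=0}^{p} (-1)^k \binom{p+1}{k} n^{p-k+1} B_k, \end{aligned}$$ where $B_k$ is the $k$th Bernoulli number.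
   Context: For all positive integers $n$ and nonnegative integers $p$, $S_p(n) = \sum_{k=1}^n k^p$ is the sum of the $p$th powers of the first $n$ positive integers. The Bernoulli numbers $B_k$ ($k \geq 0$), with the convention $B_1 = -\frac{1}{2}$, are defined by the generating function $\frac{t}{e^t - 1} = \sum_{k=0}^\infty \frac{B_k t^k}{k!}$.
   Formalization: The ''p even'' formula and the formula ending in ''+ n^p'' are asserted only for p ≥ 1, since at p = 0 they give n + 1/2 and n + 1 instead of n; the p = 0 value and the alternating-sign formula are kept for p = 0. *)

(* Defs.v *)
From Stdlib Require Import Reals Factorial Lra Lia.
From Coquelicot Require Import Coquelicot.
Local Open Scope R_scope.

(* The generating function is taken on a punctured neighbourhood of 0, because
   t / (exp t - 1) has a removable singularity at t = 0 (where Rocq's total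
   division would give 0 instead of the limit 1).  It forces B 1 = -1/2. *)
Definition bernoulli_numbers (B : nat -> R) : Prop :=
  locally' 0 (fun t : R =>
    is_series (fun k => B k * t ^ k / INR (fact k)) (t / (exp t - 1))).

Definition power_sum (p n : nat) : R := sum_n_m (fun k => INR k ^ p) 1 n.

(* Non-vacuity: a sequence satisfying [bernoulli_numbers] exists.  The row
   [bern_row n] tabulates, up to index n, the coefficients of the power series
   inverse to (exp t - 1) / t. *)
Fixpoint bern_row (n : nat) : nat -> R :=
  match n with
  | O => fun _ => 1
  | S m => fun k =>
      if Nat.leb k m then bern_row m k
      else - sum_f_R0 (fun i => bern_row m i * / INR (fact (S m - i + 1))) m
  end.

Definition bern_coef (n : nat) : R := bern_row n n.

Lemma bern_rowE (n k : nat) : (k <= n)%nat -> bern_row n k = bern_coef k.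
Proof.
induction n as [|n IH]; intros Hk.
- now replace k with O by lia.
- destruct (Nat.eq_dec k (S n)) as [->|Hne]; [reflexivity|].
  cbn [bern_row].
  replace (Nat.leb k n) with true by (symmetry; apply Nat.leb_le; lia).
  apply IH; lia.
Qed.

Lemma bern_coefS (m : nat) :
  sum_f_R0 (fun i => bern_coef i * / INR (fact (S m - i + 1))) (S m) = 0.
Proof.
cbn [sum_f_R0].
replace (S m - S m + 1)%nat with 1%nat by lia.
change (INR (fact 1)) with 1; rewrite Rinv_1, Rmult_1_r.
assert (E : bern_coef (S m) =
  - sum_f_R0 (fun i => bern_coef i * / INR (fact (S m - i + 1))) m).
{ unfold bern_coef at 1; cbn [bern_row].
  replace (Nat.leb (S m) m) with false by (symmetry; apply Nat.leb_gt; lia).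
  f_equal; apply sum_eq; intros i Hi; now rewrite bern_rowE. }
rewrite E; ring.
Qed.

Lemma inv_fact_le (j : nat) : / INR (fact (j + 2)) <= (/ 2) ^ (j + 1).
Proof.
induction j as [|j IH]; [simpl; lra|].
replace (S j + 2)%nat with (S (j + 2)) by lia.
rewrite fact_simpl, mult_INR, Rinv_mult.
replace (S j + 1)%nat with (S (j + 1)) by lia.
rewrite <- tech_pow_Rmult.
apply Rmult_le_compat; auto.
- left; apply Rinv_0_lt_compat, lt_0_INR; lia.
- left; apply Rinv_0_lt_compat, INR_fact_lt_0.
- apply Rinv_le_contravar; [lra|].
  rewrite S_INR, plus_INR; simpl; pose proof (pos_INR j); lra.
Qed.

Lemma sum_half_le (m : nat) :
  sum_f_R0 (fun i => (/ 2) ^ (m - i + 1)) m = 1 - (/ 2) ^ (m + 1).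
Proof.
induction m as [|m IH]; [simpl; lra|].
cbn [sum_f_R0].
rewrite (sum_eq _ (fun i => (/ 2) ^ (m - i + 1) * / 2)).
- rewrite <- scal_sum, IH.
  replace (S m - S m + 1)%nat with 1%nat by lia.
  replace (S m + 1)%nat with (S (m + 1)) by lia.
  simpl; field.
- intros i Hi; replace (S m - i + 1)%nat with (S (m - i + 1)) by lia.
  simpl; ring.
Qed.

Lemma bern_coef_bound (n : nat) : Rabs (bern_coef n) <= 1.
Proof.
induction n as [n IH] using (well_founded_induction Wf_nat.lt_wf).
destruct n as [|m].
- unfold bern_coef; simpl; rewrite Rabs_R1; lra.
- pose proof (bern_coefS m) as E; cbn [sum_f_R0] in E.
  replace (S m - S m + 1)%nat with 1%nat in E by lia.
  change (INR (fact 1)) with 1 in E; rewrite Rinv_1, Rmult_1_r in E.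
  replace (bern_coef (S m)) with
    (- sum_f_R0 (fun i => bern_coef i * / INR (fact (S m - i + 1))) m) by lra.
  rewrite Rabs_Ropp.
  eapply Rle_trans; [apply Rsum_abs|].
  eapply Rle_trans with (sum_f_R0 (fun i => (/ 2) ^ (m - i + 1)) m).
  + apply sum_Rle; intros i Hi.
    rewrite Rabs_mult, <- (Rmult_1_l ((/ 2) ^ _)).
    assert (0 < / INR (fact (S m - i + 1)))
      by apply Rinv_0_lt_compat, INR_fact_lt_0.
    apply Rmult_le_compat; try apply Rabs_pos; [apply IH; lia|].
    rewrite Rabs_pos_eq by lra.
    replace (S m - i + 1)%nat with (m - i + 2)%nat by lia.
    apply inv_fact_le.
  + rewrite sum_half_le.
    assert (0 < (/ 2) ^ (m + 1)) by (apply pow_lt; lra); lra.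
Qed.

Lemma abs_series_geom (a : nat -> R) (t : R) :
  (forall k, Rabs (a k) <= 1) -> Rabs t < 1 ->
  ex_series (fun k => Rabs (a k * t ^ k)).
Proof.
intros Ha Ht.
apply (ex_series_le (K := R_AbsRing) (V := R_CompleteNormedModule))
  with (fun k => Rabs t ^ k).
- intros k; change (Rabs (Rabs (a k * t ^ k)) <= Rabs t ^ k).
  rewrite Rabs_Rabsolu, Rabs_mult, <- RPow_abs.
  rewrite <- (Rmult_1_l (Rabs t ^ k)) at 2.
  apply Rmult_le_compat_r; [apply pow_le, Rabs_pos|apply Ha].
- apply ex_series_geom; now rewrite Rabs_Rabsolu.
Qed.

Lemma bernoulli_numbers_exist : exists B : nat -> R, bernoulli_numbers B.
Proof.
exists (fun k => INR (fact k) * bern_coef k).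
exists (mkposreal 1 Rlt_0_1); intros t Ht Ht0.
assert (Ht1 : Rabs t < 1).
{ change (Rabs (t - 0) < 1) in Ht; now rewrite Rminus_0_r in Ht. }
pose (e := fun k => / INR (fact (k + 1))).
assert (Hexp : is_series (fun k => e k * t ^ k) ((exp t - 1) / t)).
{ pose proof (is_exp_Reals t) as H.
  apply (is_pseries_decr_1 (K := R_AbsRing) (V := R_NormedModule) _ _ (/ t))
    in H; [|change (/ t * t = 1); now field].
  apply is_pseries_R in H.
  replace ((exp t - 1) / t) with
    (scal (/ t) (plus (exp t) (opp (/ INR (fact 0))))).
  - eapply is_series_ext; [|exact H]; intros k; unfold e, PS_decr_1.
    now replace (k + 1)%nat with (S k) by lia.
  - change (/ t * (exp t + - / 1) = (exp t - 1) / t); now field. }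
assert (He : forall k, Rabs (e k) <= 1).
{ intros k; unfold e; rewrite Rabs_pos_eq.
  - rewrite <- Rinv_1; apply Rinv_le_contravar; [lra|].
    apply (le_INR 1), lt_O_fact.
  - left; apply Rinv_0_lt_compat, INR_fact_lt_0. }
destruct (ex_series_Rabs _ (abs_series_geom _ _ bern_coef_bound Ht1))
  as [l Hl].
pose proof (is_series_mult _ _ _ _ Hl Hexp
  (abs_series_geom _ _ bern_coef_bound Ht1) (abs_series_geom _ _ He Ht1)) as H.
assert (Hprod : l * ((exp t - 1) / t) = 1).
{ rewrite <- (is_series_unique _ _ H).
  apply is_series_unique, is_series_decr_1.
  replace (plus _ _) with 0.
  - apply is_series_ext with (fun k : nat => 0).
    + intros k; symmetry.
      rewrite (sum_eq _ (fun i =>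
        bern_coef i * / INR (fact (S k - i + 1)) * t ^ S k)).
      * rewrite <- scal_sum, bern_coefS; apply Rmult_0_r.
      * intros i Hi; unfold e.
        replace (t ^ S k) with (t ^ i * t ^ (S k - i))
          by (rewrite <- pow_add; f_equal; lia).
        ring.
    + pose proof (is_series_scal_l (K := R_AbsRing) (V := R_NormedModule) 0 _ _
        (is_series_geom 0 ltac:(rewrite Rabs_R0; lra))) as H0.
      change (is_series (fun k : nat => 0 * 0 ^ k) (0 * / (1 - 0))) in H0.
      rewrite Rmult_0_l in H0.
      eapply is_series_ext; [|exact H0]; intros k; apply Rmult_0_l.
  - change (0 = 1 + - (bern_coef 0 * 1 * (/ 1 * 1))).
    unfold bern_coef; simpl; field. }
assert (Hne : exp t - 1 <> 0).
{ intros E; rewrite E in Hprod; lra. }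
replace (t / (exp t - 1)) with l.
- eapply is_series_ext; [|exact Hl]; intros k.
  change (bern_coef k * t ^ k =
          INR (fact k) * bern_coef k * t ^ k / INR (fact k)).
  pose proof (INR_fact_neq_0 k); now field.
- apply Rmult_eq_reg_r with ((exp t - 1) / t).
  + rewrite Hprod; field; auto.
  + intros E; rewrite E in Hprod; lra.
Qed.

(* Main.v *)
Require Import Defs.
From Stdlib Require Import Reals Factorial Lra Lia.
From Coquelicot Require Import Coquelicot.
Local Open Scope R_scope.

(** Write beta(t) = t / (exp t - 1) for the generating function of the B_k / k!.
    Two functional equations near 0 carry the whole proof, each read off
    coefficient by coefficient by uniqueness of power series.

    - From exp ((x+1) t) beta(t) = exp (x t) beta(t) + t exp (x t), the
      Bernoulli polynomials satisfy P_{p+1}(x+1) = P_{p+1}(x) + (p+1) x^p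
      ([bernoulli_poly_shift]).  Summing over x = 0, ..., n telescopes and gives
      (p+1) (0^p + S_p(n)) = P_{p+1}(n+1) - P_{p+1}(0)
      ([power_sum_telescopes]); one more use of the shift turns P_{p+1}(n+1)
      into P_{p+1}(n) + (p+1) n^p, which is the formula in powers of n.
    - From beta(-t) = beta(t) + t, one gets (-1)^k B_k = B_k + [k = 1]
      ([bernoulli_reflection]).  Hence the odd-indexed B_k with k <> 1 vanish,
      so that splitting P_{p+1}(n+1) according to the parity of the exponents
      of n+1 leaves one full half of the terms and, from the other half, the
      single term in B_1 = -1/2, namely - (p+1) (n+1)^p / 2.  The same
      reflection absorbs the term n^p when alternating signs are inserted in
      the formula in powers of n. *)

(** * Power series near 0 *)

(** Beyond the radius of convergence the general term does not tend to 0, so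
    one nonzero point of convergence bounds the radius from below. *)
Lemma CV_radius_pos_of_ex_pseries (a : nat -> R) :
  locally 0 (fun t => ex_pseries a t) -> Rbar_lt 0 (CV_radius a).
Proof.
intros [e He].
assert (He2 : ex_pseries a (e / 2)).
{ apply He; change (Rabs (e / 2 - 0) < e).
  rewrite Rminus_0_r, Rabs_pos_eq; pose proof (cond_pos e); lra. }
apply Rbar_lt_le_trans with (Finite (Rabs (e / 2))).
- apply Rabs_pos_lt; pose proof (cond_pos e); lra.
- apply Rbar_not_lt_le; intros H; apply (CV_disk_outside _ _ H).
  apply ex_series_lim_0.
  destruct He2 as [l Hl]; exists l; now apply is_pseries_R.
Qed.

Lemma locally_lt_CV_radius (a : nat -> R) :
  Rbar_lt 0 (CV_radius a) ->
  locally 0 (fun t => Rbar_lt (Rabs t) (CV_radius a)).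
Proof.
intros Ha.
assert (Hr : exists r : posreal, Rbar_le r (CV_radius a)).
{ destruct (CV_radius a) as [c| |]; try easy.
  - exists (mkposreal c Ha); apply Rle_refl.
  - now exists (mkposreal 1 Rlt_0_1). }
destruct Hr as [r Hr]; exists r; intros t Ht.
change (Rabs (t - 0) < r) in Ht; rewrite Rminus_0_r in Ht.
now apply Rbar_lt_le_trans with (Finite r).
Qed.

Lemma is_pseries_coef_unique (a c : nat -> R) (f : R -> R) :
  locally 0 (fun t => is_pseries a t (f t)) ->
  locally 0 (fun t => is_pseries c t (f t)) ->
  forall n, a n = c n.
Proof.
intros Ha Hc n; apply PSeries_ext_recip.
- apply CV_radius_pos_of_ex_pseries.
  eapply filter_imp, Ha; intros t Ht; now exists (f t).
- apply CV_radius_pos_of_ex_pseries.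
  eapply filter_imp, Hc; intros t Ht; now exists (f t).
- eapply filter_imp, (filter_and _ _ Ha Hc); intros t [Hat Hct].
  now rewrite (is_pseries_unique _ _ _ Hat), (is_pseries_unique _ _ _ Hct).
Qed.

Definition exp_coef (x : R) (k : nat) : R := x ^ k / INR (fact k).

Lemma is_pseries_exp_coef (x t : R) : is_pseries (exp_coef x) t (exp (x * t)).
Proof.
pose proof (is_exp_Reals (x * t)) as H.
apply is_pseries_R in H; apply is_pseries_R.
eapply is_series_ext, H; intros k; unfold exp_coef.
rewrite Rpow_mult_distr; unfold Rdiv; simpl; ring.
Qed.

Lemma CV_radius_exp_coef_pos (x : R) : Rbar_lt 0 (CV_radius (exp_coef x)).
Proof.
apply CV_radius_pos_of_ex_pseries, filter_forall; intros t.
eexists; apply is_pseries_exp_coef.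
Qed.

Lemma is_pseries_plus_mul_exp (a : nat -> R) (x t l : R) :
  is_pseries a t l ->
  is_pseries (PS_plus a (PS_incr_1 (exp_coef x))) t (l + t * exp (x * t)).
Proof.
intros Ha.
apply (is_pseries_plus (K := R_AbsRing) (V := R_NormedModule)); [exact Ha|].
apply (is_pseries_incr_1 (K := R_AbsRing) (V := R_NormedModule)).
apply is_pseries_exp_coef.
Qed.

(** * Functional equations of the generating function *)

Definition bernoulli_egf (B : nat -> R) (k : nat) : R := B k / INR (fact k).

(** Multiplying by exp t - 1 removes the singularity: the equation also holds
    at t = 0, whatever the value of the series there. *)
Lemma bernoulli_egf_eq (B : nat -> R) :
  bernoulli_numbers B ->
  Rbar_lt 0 (CV_radius (bernoulli_egf B)) /\
  locally 0 (fun t => is_pseries (bernoulli_egf B) t (PSeries (bernoulli_egf B) t)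
                      /\ PSeries (bernoulli_egf B) t * (exp t - 1) = t).
Proof.
intros HB.
assert (H : locally 0 (fun t =>
  is_pseries (bernoulli_egf B) t (PSeries (bernoulli_egf B) t)
  /\ PSeries (bernoulli_egf B) t * (exp t - 1) = t)).
{ eapply filter_imp, HB; intros t Ht.
  destruct (Req_dec t 0) as [->|Ht0].
  - split.
    + apply PSeries_correct.
      exact (ex_intro _ _ (is_pseries_0 (K := R_AbsRing) (V := R_NormedModule)
                             (bernoulli_egf B))).
    + rewrite exp_0; ring.
  - assert (Hs : is_pseries (bernoulli_egf B) t (t / (exp t - 1))).
    { apply is_pseries_R; eapply is_series_ext, (Ht Ht0).
      intros k; unfold bernoulli_egf, Rdiv; simpl; ring. }
    rewrite (is_pseries_unique _ _ _ Hs); split; [exact Hs|].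
    field; intros E; apply Ht0, exp_inv; rewrite exp_0; lra. }
split; [|exact H].
apply CV_radius_pos_of_ex_pseries.
eapply filter_imp, H; intros t [Ht _]; exact (ex_intro _ _ Ht).
Qed.

(** Coefficients of beta(-t) = t exp t / (exp t - 1) = beta(t) + t; the summand
    t is encoded as t exp (0 t), a shifted exponential series. *)
Lemma bernoulli_reflection (B : nat -> R) (k : nat) :
  bernoulli_numbers B ->
  (- 1) ^ k * B k = B k + (if Nat.eq_dec k 1 then 1 else 0).
Proof.
intros HB; destruct (bernoulli_egf_eq B HB) as [_ H].
assert (Hneg : locally 0 (fun t =>
  is_pseries (bernoulli_egf B) (- t) (PSeries (bernoulli_egf B) (- t))
  /\ PSeries (bernoulli_egf B) (- t) * (exp (- t) - 1) = - t)).
{ destruct H as [e He]; exists e; intros t Ht; apply He.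
  change (Rabs (t - 0) < e) in Ht; change (Rabs (- t - 0) < e).
  rewrite Rminus_0_r in *; now rewrite Rabs_Ropp. }
pose (X := PS_incr_1 (exp_coef 0)).
assert (E : forall k, (- 1) ^ k * bernoulli_egf B k
                      = PS_plus (bernoulli_egf B) X k).
{ apply is_pseries_coef_unique
    with (f := fun t => PSeries (bernoulli_egf B) (- t)).
  - eapply filter_imp, Hneg; intros t [Ht _].
    apply is_pseries_R in Ht; apply is_pseries_R.
    eapply is_series_ext, Ht; intros j.
    replace (- t) with (- 1 * t) by ring.
    rewrite Rpow_mult_distr; simpl; ring.
  - eapply filter_imp, (filter_and _ _ H Hneg).
    intros t [[Ht E1] [Ht' E2]].
    replace (PSeries (bernoulli_egf B) (- t))
      with (PSeries (bernoulli_egf B) t + t * exp (0 * t)).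
    + now apply is_pseries_plus_mul_exp.
    + rewrite Rmult_0_l, exp_0.
      destruct (Req_dec t 0) as [->|Ht0]; [rewrite Ropp_0; ring|].
      assert (exp t <> 1)
        by (intros Et; apply Ht0, exp_inv; now rewrite exp_0).
      pose proof (exp_pos t).
      rewrite exp_Ropp in E2.
      apply Rmult_eq_reg_r with (exp t - 1); [|lra].
      replace (PSeries (bernoulli_egf B) (- t) * (exp t - 1))
        with (- (PSeries (bernoulli_egf B) (- t) * (/ exp t - 1)) * exp t)
        by (field; lra).
      rewrite E2, Rmult_plus_distr_r, E1; ring. }
specialize (E k); unfold PS_plus, X, bernoulli_egf in E.
pose proof (INR_fact_neq_0 k) as Hk.
change (plus (B k / INR (fact k)) ?y) with (B k / INR (fact k) + y) in E.
apply Rmult_eq_reg_r with (/ INR (fact k)); [|now apply Rinv_neq_0_compat].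
transitivity ((- 1) ^ k * (B k / INR (fact k))); [unfold Rdiv; ring|].
rewrite E, Rmult_plus_distr_r; unfold Rdiv; f_equal.
destruct k as [|[|k]].
- change (0 = 0 * / INR (fact 0)); ring.
- unfold PS_incr_1, exp_coef; simpl; field.
- unfold PS_incr_1, exp_coef; simpl; unfold Rdiv; ring.
Qed.

Lemma bernoulli_odd_eq_0 (B : nat -> R) (k : nat) :
  bernoulli_numbers B -> B (2 * k + 3)%nat = 0.
Proof.
intros HB; pose proof (bernoulli_reflection B (2 * k + 3) HB) as E.
destruct (Nat.eq_dec (2 * k + 3) 1) as [|_]; [lia|].
replace (2 * k + 3)%nat with (S (2 * (k + 1))) in * by lia.
rewrite pow_1_odd in E; lra.
Qed.

(** * Boundary binomial coefficients *)

Lemma C_n_0 (n : nat) : Binomial.C n 0 = 1.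
Proof.
unfold Binomial.C; rewrite Nat.sub_0_r; simpl (fact 0); simpl (INR 1).
pose proof (INR_fact_neq_0 n); field; assumption.
Qed.

Lemma C_n_n (n : nat) : Binomial.C n n = 1.
Proof. now rewrite pascal_step1, Nat.sub_diag, C_n_0. Qed.

Lemma C_Sn_n (n : nat) : Binomial.C (S n) n = INR (S n).
Proof.
unfold Binomial.C; rewrite fact_simpl, mult_INR.
replace (S n - n)%nat with 1%nat by lia; simpl (INR (fact 1)).
pose proof (INR_fact_neq_0 n); field; assumption.
Qed.

(** * Bernoulli polynomials and telescoping *)

Definition bernoulli_poly (B : nat -> R) (m : nat) (x : R) : R :=
  sum_f_R0 (fun k => Binomial.C m k * x ^ k * B (m - k)%nat) m.

Lemma PS_mult_exp_bernoulli (B : nat -> R) (m : nat) (x : R) :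
  PS_mult (exp_coef x) (bernoulli_egf B) m
  = bernoulli_poly B m x / INR (fact m).
Proof.
unfold PS_mult, bernoulli_poly, Rdiv.
rewrite Rmult_comm, scal_sum; apply sum_eq; intros k Hk.
unfold exp_coef, bernoulli_egf, Binomial.C.
pose proof (INR_fact_neq_0 k); pose proof (INR_fact_neq_0 m).
pose proof (INR_fact_neq_0 (m - k)); field; auto.
Qed.

(** Coefficients of beta(t) exp ((x+1) t) - beta(t) exp (x t) =
    beta(t) (exp t - 1) exp (x t) = t exp (x t). *)
Lemma bernoulli_poly_shift (B : nat -> R) (p : nat) (x : R) :
  bernoulli_numbers B ->
  bernoulli_poly B (S p) (x + 1)
  = bernoulli_poly B (S p) x + INR (S p) * x ^ p.
Proof.
intros HB; destruct (bernoulli_egf_eq B HB) as [Hr H].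
assert (Hmult : forall y, locally 0 (fun t =>
  is_pseries (PS_mult (exp_coef y) (bernoulli_egf B)) t
             (exp (y * t) * PSeries (bernoulli_egf B) t))).
{ intros y.
  eapply filter_imp, (filter_and _ _ H
    (filter_and _ _ (locally_lt_CV_radius _ Hr)
       (locally_lt_CV_radius _ (CV_radius_exp_coef_pos y)))).
  intros t [[Ht _] [Hb He]].
  apply is_pseries_mult; auto using is_pseries_exp_coef. }
assert (E : forall k, PS_mult (exp_coef (x + 1)) (bernoulli_egf B) k
  = PS_plus (PS_mult (exp_coef x) (bernoulli_egf B))
            (PS_incr_1 (exp_coef x)) k).
{ eapply is_pseries_coef_unique; [apply Hmult|].
  eapply filter_imp, (filter_and _ _ H (Hmult x)).
  intros t [[_ Et] Ht].
  replace (exp ((x + 1) * t) * PSeries (bernoulli_egf B) t)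
    with (exp (x * t) * PSeries (bernoulli_egf B) t + t * exp (x * t)).
  - now apply is_pseries_plus_mul_exp.
  - replace ((x + 1) * t) with (x * t + t) by ring.
    rewrite exp_plus.
    replace (t * exp (x * t))
      with (PSeries (bernoulli_egf B) t * (exp t - 1) * exp (x * t))
      by now rewrite Et.
    ring. }
specialize (E (S p)); unfold PS_plus in E.
rewrite !PS_mult_exp_bernoulli in E.
change (bernoulli_poly B (S p) (x + 1) / INR (fact (S p))
        = bernoulli_poly B (S p) x / INR (fact (S p)) + x ^ p / INR (fact p))
  in E.
pose proof (INR_fact_neq_0 p) as Hp.
pose proof (not_0_INR (S p) ltac:(lia)) as HSp.
rewrite fact_simpl, mult_INR in E.
apply Rmult_eq_reg_r with (/ (INR (S p) * INR (fact p))).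
- unfold Rdiv in E; rewrite E; field; auto.
- apply Rinv_neq_0_compat, Rmult_integral_contrapositive; auto.
Qed.

(** Telescoping starts at x = 0 and so also counts 0 ^ p, which is 1 when
    p = 0. *)
Lemma power_sum_telescopes (B : nat -> R) (p n : nat) :
  bernoulli_numbers B ->
  INR (S p) * (0 ^ p + power_sum p n)
  = bernoulli_poly B (S p) (INR n + 1) - bernoulli_poly B (S p) 0.
Proof.
intros HB; induction n as [|n IH].
- unfold power_sum; rewrite sum_n_m_zero by lia.
  change (@zero R_AbelianMonoid) with 0; simpl (INR 0).
  rewrite (bernoulli_poly_shift B p 0 HB); ring.
- unfold power_sum; rewrite sum_n_Sm by lia; fold (power_sum p n).
  change (plus ?a ?b) with (a + b).
  rewrite bernoulli_poly_shift by exact HB.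
  rewrite <- (Rplus_assoc (0 ^ p)), Rmult_plus_distr_l, IH, (S_INR n); ring.
Qed.

Lemma bernoulli_poly_0 (B : nat -> R) (m : nat) : bernoulli_poly B m 0 = B m.
Proof.
unfold bernoulli_poly; destruct m as [|m].
- simpl; rewrite C_n_0; ring.
- rewrite decomp_sum by lia.
  rewrite (sum_eq _ (fun _ => 0)).
  + rewrite sum_cte, C_n_0, Nat.sub_0_r; simpl; ring.
  + intros i _; simpl; ring.
Qed.

(** * Splitting sums *)

Lemma sum_f_R0_last (f : nat -> R) (N : nat) :
  (forall i, (i < N)%nat -> f i = 0) -> sum_f_R0 f N = f N.
Proof.
intros Hf; destruct N as [|N]; [reflexivity|].
cbn [sum_f_R0]; rewrite (sum_eq _ (fun _ => 0)).
- rewrite sum_cte; ring.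
- intros i Hi; apply Hf; lia.
Qed.

Lemma sum_n_m_0_sum_f_R0 (f : nat -> R) (N : nat) :
  sum_n_m f 0 N = sum_f_R0 f N.
Proof. exact (sum_n_Reals f N). Qed.

(** Even exponents of x come with odd-indexed Bernoulli numbers, so only the
    exponent 2q, paired with B_1, survives among them. *)
Lemma bernoulli_poly_odd_degree (B : nat -> R) (q : nat) (x : R) :
  bernoulli_numbers B -> (1 <= q)%nat ->
  bernoulli_poly B (S (2 * q)) x
  = sum_n_m (fun k => Binomial.C (2 * q + 1) (2 * k + 1) * x ^ (2 * k + 1)
                      * B (2 * q - 2 * k)%nat) 0 q
    + INR (2 * q + 1) * x ^ (2 * q) * B 1%nat.
Proof.
intros HB Hq; unfold bernoulli_poly; rewrite sum_n_m_0_sum_f_R0.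
destruct q as [|q]; [lia|].
pose (f := fun k => Binomial.C (S (2 * S q)) k * x ^ k
                    * B (S (2 * S q) - k)%nat).
fold f.
transitivity (sum_f_R0 (fun l => f (S (2 * l))) (S q) + f (2 * S q)%nat).
- cbn [sum_f_R0]; rewrite <- (sum_decomposition f q).
  rewrite (sum_f_R0_last (fun l => f (2 * l)%nat)); [ring|].
  intros i Hi; unfold f.
  replace (S (2 * S q) - 2 * i)%nat with (2 * (q - i) + 3)%nat by lia.
  rewrite bernoulli_odd_eq_0 by exact HB; ring.
- f_equal.
  + apply sum_eq; intros k Hk; unfold f.
    replace (S (2 * S q) - S (2 * k))%nat with (2 * S q - 2 * k)%nat by lia.
    now rewrite !Nat.add_1_r.
  + unfold f; rewrite C_Sn_n.
    replace (S (2 * S q) - 2 * S q)%nat with 1%nat by lia.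
    now rewrite Nat.add_1_r.
Qed.

(** Odd exponents of x come with odd-indexed Bernoulli numbers, so only the
    exponent 2q+1, paired with B_1, survives among them. *)
Lemma bernoulli_poly_even_degree (B : nat -> R) (q : nat) (x : R) :
  bernoulli_numbers B ->
  bernoulli_poly B (2 * S q) x
  = B (2 * S q)%nat
    + sum_n_m (fun k => Binomial.C (2 * S q) (2 * k) * x ^ (2 * k)
                        * B (2 * S q - 2 * k)%nat) 1 (S q)
    + INR (2 * S q) * x ^ S (2 * q) * B 1%nat.
Proof.
intros HB; unfold bernoulli_poly.
pose (f := fun k => Binomial.C (2 * S q) k * x ^ k * B (2 * S q - k)%nat).
fold f; rewrite <- (sum_decomposition f q).
rewrite (sum_f_R0_last (fun l => f (S (2 * l)))).
- f_equal.
  + rewrite <- sum_n_m_0_sum_f_R0, sum_Sn_m by lia.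
    change (plus ?a ?b) with (a + b); f_equal.
    unfold f; rewrite C_n_0, Nat.mul_0_r, Nat.sub_0_r; simpl; ring.
  + unfold f; replace (2 * S q)%nat with (S (S (2 * q))) by lia.
    rewrite C_Sn_n.
    now replace (S (S (2 * q)) - S (2 * q))%nat with 1%nat by lia.
- intros i Hi; unfold f.
  replace (2 * S q - S (2 * i))%nat with (2 * (q - 1 - i) + 3)%nat by lia.
  rewrite bernoulli_odd_eq_0 by exact HB; ring.
Qed.

(** * Faulhaber's formulas *)

Lemma bernoulli_poly_descending (B : nat -> R) (p : nat) (x : R) :
  bernoulli_poly B (S p) x
  = sum_n_m (fun k => Binomial.C (p + 1) k * x ^ (p + 1 - k) * B k) 0 p
    + B (S p).
Proof.
unfold bernoulli_poly; rewrite <- sum_f_R0_skip; cbn [sum_f_R0].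
rewrite sum_n_m_0_sum_f_R0, !Nat.add_1_r; f_equal.
- apply sum_eq; intros k Hk.
  rewrite <- pascal_step1 by lia.
  now replace (S p - (S p - k))%nat with k by lia.
- rewrite !Nat.sub_diag, Nat.sub_0_r, C_n_0; simpl; ring.
Qed.

Lemma power_sum_eq_bernoulli_poly (B : nat -> R) (p n : nat) :
  bernoulli_numbers B -> (1 <= p)%nat ->
  power_sum p n
  = 1 / INR (p + 1) * (bernoulli_poly B (S p) (INR (n + 1)) - B (S p)).
Proof.
intros HB Hp.
rewrite (plus_INR n 1), <- (bernoulli_poly_0 B (S p)); change (INR 1) with 1.
rewrite <- power_sum_telescopes, pow_i, Rplus_0_l by (exact HB || lia).
rewrite Nat.add_1_r.
pose proof (not_0_INR (S p) ltac:(lia)); field; assumption.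
Qed.

Lemma power_sum_eq_descending (B : nat -> R) (p n : nat) :
  bernoulli_numbers B -> (1 <= p)%nat ->
  power_sum p n
  = 1 / INR (p + 1)
    * sum_n_m (fun k => Binomial.C (p + 1) k * INR n ^ (p + 1 - k) * B k) 0 p
    + INR n ^ p.
Proof.
intros HB Hp.
rewrite (power_sum_eq_bernoulli_poly B) by assumption.
rewrite (plus_INR n 1); change (INR 1) with 1.
rewrite bernoulli_poly_shift, bernoulli_poly_descending by exact HB.
rewrite <- (Nat.add_1_r p).
pose proof (not_0_INR (p + 1) ltac:(lia)); field; assumption.
Qed.

(** By reflection (-1)^k B_k - B_k = [k = 1], so the signs change only the term
    k = 1, whose cofactor is p + 1 choose 1 times x ^ p. *)
Lemma alternating_bernoulli_sum (B : nat -> R) (p : nat) (x : R) :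
  bernoulli_numbers B -> (1 <= p)%nat ->
  sum_n_m (fun k => (- 1) ^ k * Binomial.C (p + 1) k * x ^ (p + 1 - k) * B k)
          0 p
  = sum_n_m (fun k => Binomial.C (p + 1) k * x ^ (p + 1 - k) * B k) 0 p
    + INR (p + 1) * x ^ p.
Proof.
intros HB Hp.
destruct p as [|p]; [lia|].
rewrite !(sum_Sn_m _ 0), !(sum_Sn_m _ 1) by lia.
repeat change (plus ?a ?b) with (a + b).
match goal with |- ?l = ?r => change (@eq R l r) end.
replace (Binomial.C (S p + 1) 1) with (INR (S p + 1)).
2:{ rewrite Nat.add_1_r, (pascal_step1 _ 1) by lia.
    replace (S (S p) - 1)%nat with (S p) by lia.
    now rewrite C_Sn_n. }
pose proof (bernoulli_reflection B 1 HB) as E1; simpl in E1.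
rewrite (sum_n_m_ext_loc
  (fun k => (- 1) ^ k * Binomial.C (S p + 1) k * x ^ (S p + 1 - k) * B k)
  (fun k => Binomial.C (S p + 1) k * x ^ (S p + 1 - k) * B k) 2).
- replace (S p + 1 - 1)%nat with (S p) by lia.
  rewrite pow_1, pow_O; replace (B 1%nat) with (- (1 / 2)) by lra; field.
- intros k Hk; pose proof (bernoulli_reflection B k HB) as E.
  destruct (Nat.eq_dec k 1) as [|_]; [lia|].
  rewrite Rplus_0_r in E; rewrite <- E at 2; simpl; ring.
Qed.

Lemma bernoulli_0 (B : nat -> R) : bernoulli_numbers B -> B 0%nat = 1.
Proof.
intros HB; pose proof (bernoulli_poly_shift B 0 0 HB) as E.
unfold bernoulli_poly in E; simpl in E.
rewrite !C_n_0, !C_n_n in E; lra.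
Qed.

Theorem theorem1 (B : nat -> R) (hB : bernoulli_numbers B)
    (hB1 : B 1%nat = - (1 / 2)) (n p : nat) (hn : (1 <= n)%nat) :
  (p = 0%nat -> power_sum p n = INR n) /\
  ((1 <= p)%nat ->
    (Nat.Even p ->
      power_sum p n =
        1 / INR (p + 1) *
          sum_n_m (fun k => Binomial.C (p + 1) (2 * k + 1)
                            * INR (n + 1) ^ (2 * k + 1) * B (p - 2 * k)%nat)
            0 (p / 2)
        - INR (n + 1) ^ p / 2) /\
    (Nat.Odd p ->
      power_sum p n =
        1 / INR (p + 1) *
          sum_n_m (fun k => Binomial.C (p + 1) (2 * k)
                            * INR (n + 1) ^ (2 * k) * B (p + 1 - 2 * k)%nat)
            1 ((p + 1) / 2)
        - INR (n + 1) ^ p / 2) /\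
    power_sum p n =
      1 / INR (p + 1) *
        sum_n_m (fun k => Binomial.C (p + 1) k
                          * INR n ^ (p + 1 - k) * B k) 0 p
      + INR n ^ p) /\
  power_sum p n =
    1 / INR (p + 1) *
      sum_n_m (fun k => (- 1) ^ k * Binomial.C (p + 1) k
                        * INR n ^ (p + 1 - k) * B k) 0 p.
Proof.
assert (H0 : power_sum 0 n = INR n).
{ unfold power_sum; rewrite (sum_n_m_ext _ (fun _ => 1)) by reflexivity.
  rewrite sum_n_m_const, Nat.sub_succ, Nat.sub_0_r; ring. }
split; [now intros ->|split].
- intros Hp; split; [|split].
  + intros [q ->].
    rewrite (power_sum_eq_bernoulli_poly B) by assumption.
    rewrite bernoulli_poly_odd_degree, hB1 by (exact hB || lia).
    replace (S (2 * q)) with (2 * (q - 1) + 3)%nat by lia.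
    rewrite bernoulli_odd_eq_0 by exact hB.
    replace (2 * q / 2)%nat with q
      by (now rewrite Nat.mul_comm, Nat.div_mul by lia).
    pose proof (not_0_INR (2 * q + 1) ltac:(lia)); field; assumption.
  + intros [q ->].
    rewrite (power_sum_eq_bernoulli_poly B) by assumption.
    replace (S (2 * q + 1)) with (2 * S q)%nat by lia.
    rewrite bernoulli_poly_even_degree, hB1 by exact hB.
    replace (2 * q + 1 + 1)%nat with (2 * S q)%nat by lia.
    replace (2 * S q / 2)%nat with (S q)
      by (now rewrite Nat.mul_comm, Nat.div_mul by lia).
    replace (2 * q + 1)%nat with (S (2 * q)) by lia.
    pose proof (not_0_INR (2 * S q) ltac:(lia)); field; assumption.
  + now apply power_sum_eq_descending.
- destruct (Nat.eq_dec p 0) as [->|Hp].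
  + rewrite H0, sum_n_m_0_sum_f_R0; simpl.
    rewrite C_n_0, bernoulli_0 by exact hB; field.
  + rewrite alternating_bernoulli_sum by (exact hB || lia).
    rewrite (power_sum_eq_descending B) by (exact hB || lia).
    pose proof (not_0_INR (p + 1) ltac:(lia)); field; assumption.
Qed.
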